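(* Let $P$ and $Q$ be two polytopes in $\mathbb{R}^n$ whose fundamental hyperplane arrangements satisfy $\mathcal{H}_Q\subset\mathcal{H}_P$, and suppose that both are positively oriented by the same vector $\vec v\in\mathbb{R}^n$. For each $H\in\mathcal{H}_P$ choose a normal vector $\vec d_H$ of $H$ with $\langle\vec d_H,\vec v\rangle>0$. Let $F,G$ be nonempty faces of $Q$, and let $\{\vec F_i\}_i$ (resp. $\{\vec G_j\}_j$) be a family consisting of one outward pointing normal vector for each facet of $Q$ containing $F$ (resp. $G$). Then $$(F,G)\in\operatorname{Im}\triangle_{(Q,\vec v)}\iff \forall H\in\mathcal{H}_P,\ \exists i,\ \langle\vec F_i,\vec d_H\rangle<0\ \text{ or }\ \exists j,\ \langle\vec G_j,\vec d_H\rangle>0 .$$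
   Context: For a polytope $P\subset\mathbb{R}^n$ and $z\in P$ put $\rho_zP=2z-P$. $P$ is positively oriented by $\vec v$ if for every $z\in P$ the vector $\vec v$ is not perpendicular to any edge of $P\cap\rho_zP$. The fundamental hyperplane arrangement $\mathcal{H}_P$ is the collection of all linear hyperplanes of $\mathbb{R}^n$ orthogonal to the direction of an edge of $P\cap\rho_zP$, for some $z\in P$. For $(Q,\vec v)$ positively oriented, $\langle -,\vec v\rangle$ has on each $Q\cap\rho_zQ$ a unique minimizer $\operatorname{bot}(Q\cap\rho_zQ)$ and a unique maximizer $\operatorname{top}(Q\cap\rho_zQ)$, and the bot-top diagonal is $\triangle_{(Q,\vec v)}:Q\to Q\times Q$, $z\mapsto(\operatorname{bot}(Q\cap\rho_zQ),\operatorname{top}(Q\cap\rho_zQ))$. Its image is a union of faces $F\times G$ of $Q\times Q$, and ''$(F,G)\in\operatorname{Im}\triangle_{(Q,\vec v)}$'' means $F\times G\subset\operatorname{Im}\triangle_{(Q,\vec v)}$. A vector $\vec d\in\mathbb{R}^n$ is an outward pointing normal vector for a facet (codimension one face) $E$ of $Q$ if for some $c\in\mathbb{R}$ the hyperplane $\{x:\langle\vec d,x\rangle=c\}$ meets $Q$ exactly in $E$ and no point $x\in Q$ has $\langle\vec d,x\rangle>c$.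
   Formalization: The formal theorem adds the hypothesis dim P = dim Q; without it the claim fails, e.g. n = 1, P = [0,1], Q = F = G = {0}, v = 1, where (F,G) is in the image but Q has no facet containing F or G. *)

(* Defs.v *)
From mathcomp Require Import all_boot all_order all_algebra.
From mathcomp Require Import boolp classical_sets reals.

Set Implicit Arguments.
Unset Strict Implicit.
Unset Printing Implicit Defensive.

Import Order.TTheory GRing.Theory Num.Theory.

Local Open Scope classical_set_scope.
Local Open Scope ring_scope.

Section Polytopes.
Variables (R : realType) (n : nat).
Local Notation V := 'rV[R]_n.
Implicit Types (A E P : set V) (H : set V) (d u v x y z : V).

Definition dot u v : R := \sum_(i < n) u 0 i * v 0 i.

Definition conv_hull (k : nat) (p : 'I_k -> V) : set V :=
  [set x | exists a : 'I_k -> R,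
    [/\ forall i, 0 <= a i, \sum_i a i = 1 & x = \sum_i a i *: p i]].

(* The empty polytope (k = 0) is allowed. *)
Definition polytope P := exists (k : nat) (p : 'I_k -> V), P = conv_hull p.

(* The dimension of the affine hull: the largest k such that A contains k + 1
   affinely independent points x0, ..., xk. The empty set gets the value 0. *)
Definition aff_dim A : nat :=
  \max_(k < n.+1 | `[< exists (x0 : V) (s : seq V),
      [/\ A x0, forall x, x \in s -> A x, size s = k
        & free [seq x - x0 | x <- s]] >]) k.

(* Taking d = 0 shows that P and set0 are faces of P. *)
Definition face E P := exists (d : V) (c : R),
  (forall x, P x -> dot d x <= c) /\ E = P `&` [set x | dot d x = c].

Definition edge E P := face E P /\ aff_dim E = 1%N.

Definition facet E P := [/\ face E P, E !=set0 & (aff_dim E).+1 = aff_dim P].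

Definition outward_normal d E P := exists c : R,
  P `&` [set x | dot d x = c] = E /\ (forall x, P x -> ~ (dot d x > c)).

Definition rho z P : set V := [set z *+ 2 - x | x in P].

(* The direction of an edge E is the line spanned by x - y, for any two
   distinct points x and y of E. *)
Definition edge_direction d E := exists x y, [/\ E x, E y, x <> y & d = x - y].

Definition positively_oriented P v :=
  forall z, P z -> forall E, edge E (P `&` rho z P) ->
  forall d, edge_direction d E -> dot d v <> 0.

Definition orthogonal_hyperplane d : set V := [set x | dot d x = 0].

Definition fundamental_arrangement P : set (set V) :=
  [set H | exists z E d, [/\ P z, edge E (P `&` rho z P), edge_direction d E
                           & H = orthogonal_hyperplane d]].

Definition normal_vector d H := d <> 0 /\ forall x, H x -> dot d x = 0.

Definition minimizers v A : set V :=
  [set x | A x /\ forall y, A y -> dot x v <= dot y v].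

Definition maximizers v A : set V :=
  [set x | A x /\ forall y, A y -> dot y v <= dot x v].

(* xget 0 selects an element of a set, with default value 0 if it is empty.
   The minimizer and the maximizer exist and are unique when A is
   P `&` rho z P with z in P and (P, v) positively oriented. *)
Definition bot v A : V := xget 0 (minimizers v A).
Definition top v A : V := xget 0 (maximizers v A).

Definition diagonal P v z : V * V :=
  (bot v (P `&` rho z P), top v (P `&` rho z P)).

Definition in_diagonal_image P v (F G : set V) :=
  F `*` G `<=` diagonal P v @` P.

End Polytopes.

(* Main.v *)
(* Write R_z for the intersection of Q and 2z - Q. The reflection in z swaps the
   minimizer and the maximizer of v on R_z, so (x, y) is in the image of the
   diagonal exactly when x minimizes v on R_z with z = (x + y) / 2.
   If x is not a minimizer, some edge of R_z has a direction u that is feasible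
   at x and satisfies <u, v> < 0. Then d_H is a negative multiple of u for
   H = orthogonal of u, and feasibility of x + e u and y - e u violates the
   condition at H. Conversely, if the condition fails at H, then for x and y in
   the relative interiors of F and G the points x - e d_H and y + e d_H remain
   in Q, because the facets of Q through x are those containing F; so x is not
   a minimizer. This uses d_H in lin Q, which holds since the inclusion of
   arrangements and the equality of dimensions force lin P = lin Q. *)
Require Import Defs.
From mathcomp Require Import all_boot all_order all_algebra.
From mathcomp Require Import boolp classical_sets reals.
From mathcomp Require Import ring lra.

Import Order.TTheory GRing.Theory Num.Theory.

Local Open Scope classical_set_scope.
Local Open Scope ring_scope.

Set Implicit Arguments.
Unset Strict Implicit.
Unset Printing Implicit Defensive.

(** * Counting arguments and the ratio test *)

Lemma leq_count_in (T : eqType) (p q : pred T) (s : seq T) :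
  (forall j, j \in s -> p j -> q j) -> (count p s <= count q s)%N.
Proof.
elim: s => //= a s IH pq; rewrite leq_add //.
  by have := pq a (mem_head _ _); case: (p a) => // ->.
by apply: IH => j js; apply: pq; rewrite inE js orbT.
Qed.

(** Supplies the strict progress in the inductions on numbers of constraints. *)
Lemma ltn_count (T : eqType) (p q : pred T) (s : seq T) (k : T) :
  (forall j, j \in s -> p j -> q j) -> k \in s -> ~~ p k -> q k ->
  (count p s < count q s)%N.
Proof.
elim: s => // a s IH pq; rewrite inE => ks npk qk /=.
have pqs : forall j, j \in s -> p j -> q j.
  by move=> j js; apply: pq; rewrite inE js orbT.
have pqa : (p a <= q a)%N.
  by have := pq a (mem_head _ _); case: (p a) => // ->.
case/orP: ks => [/eqP ka | ks]; last by rewrite -addnS leq_add // IH.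
rewrite -ka (negbTE npk) qk /= add0n add1n ltnS; exact: leq_count_in.
Qed.

(** The ratio test: [t] is the least of the ratios [- f k / g k] over the [k] with [0 < g k]. *)
Lemma first_hit (R : realFieldType) (T : eqType) (s : seq T) (f g : T -> R) :
  (forall k, k \in s -> f k <= 0) -> (exists2 k, k \in s & 0 < g k) ->
  exists t, [/\ 0 <= t, forall k, k \in s -> f k + t * g k <= 0
    & exists k, [/\ k \in s, 0 < g k & f k + t * g k = 0]].
Proof.
elim: s => [_ [] //|a s IH f_le0 [k0]].
rewrite inE => k0s gk0.
have fa : f a <= 0 by apply: f_le0; rewrite mem_head.
have fs k : k \in s -> f k <= 0 by move=> ks; apply: f_le0; rewrite inE ks orbT.
have hit_a : 0 < g a -> (forall k, k \in s -> f k - f a / g a * g k <= 0) ->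
  exists t, [/\ 0 <= t, forall k, k \in a :: s -> f k + t * g k <= 0
    & exists k, [/\ k \in a :: s, 0 < g k & f k + t * g k = 0]].
  move=> ga hs; exists (- f a / g a).
  have e : f a + - f a / g a * g a = 0 by field; apply: lt0r_neq0.
  split.
  - by rewrite divr_ge0 // ?oppr_ge0 // ltW.
  - move=> k; rewrite inE => /orP[/eqP ->|/hs]; first by rewrite e.
    by rewrite !mulNr.
  - by exists a; rewrite mem_head.
have [[k ks gk]|nex] := pselect (exists2 k, k \in s & 0 < g k).
  have [t [t0 ht [j [js gj ej]]]] := IH fs (ex_intro2 _ _ k ks gk).
  (* The value [t] found for the tail survives unless it violates the constraint at [a]; in that
     case the ratio at [a] is smaller. *)
  have [le|gt] := leP (f a + t * g a) 0.
    exists t; split=> //.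
      by move=> i; rewrite inE => /orP[/eqP ->//|/ht].
    by exists j; rewrite inE js orbT.
  have ga : 0 < g a.
    rewrite ltNge; apply/negP => ga.
    have := mulr_ge0_le0 t0 ga; lra.
  apply: hit_a => // i i_s.
  have e : f a / g a * g a = f a by field; apply: lt0r_neq0.
  have tb : - (f a / g a) < t.
    by rewrite -(ltr_pM2r ga); lra.
  have nn : 0 <= - (f a / g a) by rewrite -mulNr divr_ge0 // ?oppr_ge0 // ltW.
  have := ht i i_s; have := fs i i_s.
  by have [gi|gi] := leP (g i) 0; nra.
have gs k : k \in s -> g k <= 0.
  by move=> ks; rewrite leNgt; apply/negP => gk; apply: nex; exists k.
have ga : 0 < g a.
  by case/orP: k0s => [/eqP <-//|/gs]; rewrite leNgt gk0.
apply: hit_a => // i i_s.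
have nn : 0 <= - (f a / g a) by rewrite -mulNr divr_ge0 // ?oppr_ge0 // ltW.
by have := gs i i_s; have := fs i i_s; nra.
Qed.

Section Polyhedra.
Variables (R : realType) (n : nat).
Local Notation V := 'rV[R]_n.
Implicit Types (A E : set V) (l : seq (V * R)) (k : V * R) (u v w x y z : V).

(** * Bilinearity and positivity of the inner product *)

Lemma dotC u v : dot u v = dot v u.
Proof. by apply: eq_bigr => i _; rewrite mulrC. Qed.

Lemma dotDr u v w : dot u (v + w) = dot u v + dot u w.
Proof. by rewrite -big_split; apply: eq_bigr => i _; rewrite mxE mulrDr. Qed.

Lemma dotZr a u v : dot u (a *: v) = a * dot u v.
Proof. by rewrite mulr_sumr; apply: eq_bigr => i _; rewrite mxE; ring. Qed.

Lemma dotNr u v : dot u (- v) = - dot u v.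
Proof. by rewrite -scaleN1r dotZr mulN1r. Qed.

Lemma dotBr u v w : dot u (v - w) = dot u v - dot u w.
Proof. by rewrite dotDr dotNr. Qed.

Lemma dot0r u : dot u 0 = 0.
Proof. by rewrite -(scale0r 0) dotZr mul0r. Qed.

Lemma dotDl u v w : dot (v + w) u = dot v u + dot w u.
Proof. by rewrite !(dotC _ u) dotDr. Qed.

Lemma dotZl a u v : dot (a *: v) u = a * dot v u.
Proof. by rewrite !(dotC _ u) dotZr. Qed.

Lemma dotNl u v : dot (- v) u = - dot v u.
Proof. by rewrite !(dotC _ u) dotNr. Qed.

Lemma dotBl u v w : dot (v - w) u = dot v u - dot w u.
Proof. by rewrite dotDl dotNl. Qed.

Lemma dot0l u : dot 0 u = 0.
Proof. by rewrite dotC dot0r. Qed.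

Definition dotE := (dotDr, dotDl, dotNr, dotNl, dotZr, dotZl, dot0r, dot0l).

Lemma dot_gt0 u : u <> 0 -> 0 < dot u u.
Proof.
move=> u0; rewrite lt_neqAle eq_sym sumr_ge0 ?andbT; last first.
  by move=> i _; rewrite -expr2 sqr_ge0.
apply/eqP => e; apply: u0; apply/rowP => i; rewrite mxE.
apply/eqP; rewrite -(sqrf_eq0 (u 0 i)) expr2.
move/eqP: e; rewrite psumr_eq0; last by move=> j _; rewrite -expr2 sqr_ge0.
by move/allP => /(_ i (mem_index_enum i)).
Qed.

(** * Polyhedra and descending edge directions *)

Definition hpoly l : set V := [set x | forall k, k \in l -> dot k.1 x <= k.2].

Definition tight x k := dot k.1 x == k.2.

(** For [x] in [hpoly l], the lineality space of the cone of feasible directions at [x]. At a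
    relative interior point it is the linear space parallel to the affine hull. *)
Definition lineality l x w := forall k, k \in l -> tight x k -> dot k.1 w = 0.

(** The form in which boundedness is used: a nonzero direction must run into some constraint. *)
Definition no_ray A :=
  forall x w, (forall s, 0 <= s -> A (x + s *: w)) -> w = 0.

(** Constraints slack at [x] leave room for a short step, so only the tight ones restrict the
    direction. *)
Lemma hpoly_step l x w : hpoly l x ->
  (forall k, k \in l -> tight x k -> dot k.1 w <= 0) ->
  exists2 e, 0 < e & forall t, 0 <= t <= e ->
    hpoly l (x + t *: w) /\
    forall k, k \in l -> ~~ tight x k -> dot k.1 (x + t *: w) < k.2.
Proof.
elim: l => [_ _|k l IH hx hw]; first by exists 1.
have [||e e0 he] := IH.
- by move=> j jl; apply: hx; rewrite inE jl orbT.
- by move=> j jl; apply: hw; rewrite inE jl orbT.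
have hk := hx k (mem_head _ _).
have [tk|ntk] := boolP (tight x k).
  exists e => // t te; have [h1 h2] := he t te; split=> j; rewrite inE.
  - move=> /orP[/eqP ->|/h1//]; have := hw k (mem_head _ _) tk.
    case/andP: te => t0 _ wk; move: tk; rewrite /tight !dotE => /eqP ->.
    by rewrite gerDl mulr_ge0_le0.
  - by move=> /orP[/eqP -> /negP|/h2//].
have gap : 0 < k.2 - dot k.1 x.
  by rewrite subr_gt0 lt_neqAle hk andbT.
have n1 : 0 < 1 + `|dot k.1 w| by rewrite ltr_pwDl.
(* The summand 1 avoids a division by zero and keeps the constraint strict after the step. *)
have e1 : 0 < (k.2 - dot k.1 x) / (1 + `|dot k.1 w|) by rewrite divr_gt0.
exists (Num.min e ((k.2 - dot k.1 x) / (1 + `|dot k.1 w|))).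
  by rewrite lt_min e0.
move=> t; rewrite le_min => /and3P[t0 te tg].
have [|h1 h2] := he t; first by rewrite t0.
have hs : dot k.1 (x + t *: w) < k.2.
  rewrite ler_pdivlMr // in tg; rewrite !dotE.
  have := ler_wpM2l t0 (ler_norm (dot k.1 w)); rewrite mulrDr mulr1 in tg.
  by have [t1|t1] := ltP 0 t; [lra | have -> : t = 0 by lra]; lra.
split=> j; rewrite inE.
- by move=> /orP[/eqP ->|/h1//]; exact: ltW.
- by move=> /orP[/eqP -> _|/h2].
Qed.

(* A feasible descending direction [w] at [x] that makes as many constraints
   tight at [x] as possible spans an extreme ray of the cone of feasible
   directions, as long as no line in this cone is orthogonal to [v]. *)
Lemma pointed_edge_descent l v x w : hpoly l x ->
  (forall k, k \in l -> tight x k -> dot k.1 w <= 0) -> dot w v < 0 ->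
  (forall w', lineality l x w' -> dot w' v = 0 -> w' = 0) ->
  exists m u, [/\ hpoly l m, lineality l m u,
    forall w', lineality l m w' -> exists a, w' = a *: u, dot u v < 0
    & forall k, k \in l -> tight x k -> dot k.1 u <= 0].
Proof.
move=> hx hw wv pt.
(* Induction on the number of constraints that are not both tight at [x] and orthogonal to [w]. *)
have [N] := ubnP (size l - count (fun k => tight x k && (dot k.1 w == 0)) l).
elim: N w hw wv => // N IH w hw wv szN.
have [e e0 he] := hpoly_step hx hw.
have [|hm sm] := he e; first by rewrite lexx ltW.
(* After the step, exactly those constraints remain tight that were tight at [x] and orthogonal to
   [w]. *)
have tm k : k \in l -> tight (x + e *: w) k -> tight x k /\ dot k.1 w = 0.
  move=> kl tk; have [tx|ntx] := boolP (tight x k); last first.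
    by have := sm k kl ntx; rewrite lt_neqAle (eqP tk) eqxx.
  split=> //; move: tk tx; rewrite /tight !dotE => /eqP <- /eqP/esym.
  rewrite -{2}[dot k.1 x]addr0 => /addrI/eqP.
  by rewrite mulf_eq0 (gt_eqF e0) => /eqP.
have tm' k : tight x k -> dot k.1 w = 0 -> tight (x + e *: w) k.
  by rewrite /tight !dotE => /eqP -> ->; rewrite mulr0 addr0.
have [line|] := pselect (forall w', lineality l (x + e *: w) w' ->
                           exists a, w' = a *: w).
  by exists (x + e *: w), w; split=> // k kl /(tm k kl)[].
move/existsNP => [w0] /not_implyP[lw0 nw0].
pose w1 := w0 - (dot w0 v / dot w v) *: w.
have wv0 : dot w v != 0 by rewrite lt_eqF.
have w1v : dot w1 v = 0 by rewrite /w1 !dotE; field.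
have lw1 : lineality l (x + e *: w) w1.
  by move=> k kl tk; rewrite /w1 !dotE (lw0 k kl tk) (tm k kl tk).2 mulr0 subr0.
have w10 : w1 <> 0.
  by move=> /eqP; rewrite subr_eq0 => /eqP e0'; apply: nw0; exists (dot w0 v / dot w v).
(* By [pt], some constraint tight at [x] is not orthogonal to [w1]; the sign of [w2] makes it
   increase there. *)
have [w2 [w2v lw2 [k kl /andP[tk kw2]]]] : exists w2, [/\ dot w2 v = 0,
    lineality l (x + e *: w) w2
    & exists2 k, k \in l & tight x k && (0 < dot k.1 w2)].
  have [k [kl tk kw1]] : exists k, [/\ k \in l, tight x k & dot k.1 w1 != 0].
    apply: contrapT => nk; apply/w10/pt => // k kl tk; apply/eqP/negPn/negP.
    by move=> kw; apply: nk; exists k.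
  case: (ltgtP (dot k.1 w1) 0) kw1 => // kw1 _; last first.
    by exists w1; split=> //; exists k => //; rewrite tk.
  exists (- w1); split; first by rewrite dotNl w1v oppr0.
    by move=> j jl tj; rewrite dotNr lw1 ?oppr0.
  by exists k => //; rewrite tk dotNr oppr_gt0.
(* Tilting [w] by [w2] keeps [dot w v]; it stops when one more tight constraint becomes
   orthogonal. *)
have [||s [s0 hs [j [jl gj ej]]]] :=
    @first_hit R _ [seq k <- l | tight x k] (fun k => dot k.1 w) (fun k => dot k.1 w2).
- by move=> j; rewrite mem_filter => /andP[tj jl]; apply: hw.
- by exists k => //; rewrite mem_filter tk.
move: jl; rewrite mem_filter => /andP[tj jl].
apply: (IH (w + s *: w2)).
- by move=> i il ti; rewrite !dotE; apply: hs; rewrite mem_filter ti.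
- by rewrite !dotE w2v mulr0 addr0.
have lt : (count (fun k => tight x k && (dot k.1 w == 0)%R) l <
   count (fun k => tight x k && (dot k.1 (w + s *: w2) == 0)%R) l)%N.
  apply: (@ltn_count _ _ _ _ j) => // [i il /andP[ti /eqP wi]||].
  - by rewrite ti !dotE wi lw2 ?tm' // mulr0 addr0 eqxx.
  - rewrite tj /=; apply/negP => /eqP wj.
    by move: gj; rewrite lw2 ?tm' // ltxx.
  - by rewrite tj !dotE ej eqxx.
rewrite ltnS in szN; apply: leq_trans szN; apply: ltn_sub2l => //.
by apply: leq_trans lt _; apply: count_size.
Qed.

(* A line in the cone of feasible directions that is orthogonal to [v] is used
   to move [x] until one more constraint is tight, keeping the value of [v]. *)
Lemma edge_descent l v x y : no_ray (hpoly l) ->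
  hpoly l x -> hpoly l y -> dot y v < dot x v ->
  exists m u, [/\ hpoly l m, lineality l m u,
    forall w, lineality l m w -> exists a, w = a *: u, dot u v < 0
    & forall k, k \in l -> tight x k -> dot k.1 u <= 0].
Proof.
move=> nr; have [N] := ubnP (size l - count (tight x) l).
elim: N x y => // N IH x y szN hx hy yx.
have [pt|] := pselect (forall w', lineality l x w' -> dot w' v = 0 -> w' = 0).
  apply: (pointed_edge_descent (w := y - x)) => //.
  - by move=> k kl tk; have := hy k kl; rewrite !dotE (eqP tk) subr_le0.
  - by rewrite !dotE subr_lt0.
move/existsNP => [w] /not_implyP[lw] /not_implyP[wv w0].
have [k kl kw] : exists2 k, k \in l & 0 < dot k.1 w.
  apply: contrapT => nk; apply: w0; apply: (nr x) => s s0 k kl.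
  have kw : dot k.1 w <= 0.
    by rewrite leNgt; apply/negP => kw; apply: nk; exists k.
  by have := hx k kl; rewrite !dotE; nra.
have [||s [s0 hs [j [jl gj ej]]]] :=
    @first_hit R _ l (fun k => dot k.1 x - k.2) (fun k => dot k.1 w).
- by move=> j jl; rewrite subr_le0 hx.
- by exists k.
(* Tight constraints stay tight, so a direction feasible at the new point is also feasible at
   [x]. *)
have tx i : i \in l -> tight x i -> tight (x + s *: w) i.
  by move=> il ti; rewrite /tight !dotE lw // mulr0 addr0.
have [|||| m [u [hm lu line uv fu]]] := IH (x + s *: w) y.
- rewrite ltnS in szN.
  have lt : (count (tight x) l < count (tight (x + s *: w)) l)%N.
    apply: (@ltn_count _ _ _ _ j) => //.
    + by apply/negP => tj; move: gj; rewrite lw // ltxx.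
    + by rewrite /tight !dotE -subr_eq0 -ej; apply/eqP; ring.
  apply: leq_trans szN; apply: ltn_sub2l => //.
  by apply: leq_trans lt _; apply: count_size.
- by move=> i il; have := hs i il; rewrite !dotE; lra.
- by [].
- by rewrite !dotE wv mulr0 addr0.
by exists m, u; split=> // i il ti; apply: fu => //; apply: tx.
Qed.

(** * Polytopes as intersections of half-spaces *)

(** Describes the sum of the cone of [l] and the ray through [(p, 1)] by eliminating [s]: a positive
    [al k] bounds [s] below, a negative one bounds it above, and [mix] compares the two kinds of
    bounds. *)
Lemma fourier_motzkin l (p : V) : exists l', forall x t,
  (exists2 s, 0 <= s &
     forall k, k \in l -> dot k.1 (x - s *: p) <= k.2 * (t - s)) <->
  (forall k, k \in l' -> dot k.1 x <= k.2 * t).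
Proof.
pose al k := dot k.1 p - k.2.
pose mix k j := (al k *: j.1 - al j *: k.1, al k * j.2 - al j * k.2) : V * R.
exists ([seq k <- l | al k <= 0] ++
  [seq mix k j | k <- [seq k <- l | 0 < al k], j <- [seq k <- l | al k < 0]]).
move=> x t; pose f k := dot k.1 x - k.2 * t.
have fE s k : (dot k.1 (x - s *: p) <= k.2 * (t - s)) = (f k <= s * al k).
  by rewrite -subr_le0 -(subr_le0 _ (f k)) !dotE /f /al; congr (_ <= _); ring.
split=> [[s s0 hs] k|h].
  rewrite mem_cat => /orP[|/allpairsP[[k1 j1] /= []]].
    rewrite mem_filter => /andP[ak /hs]; rewrite fE /f.
    by have := mulr_ge0_le0 s0 ak; lra.
  rewrite !mem_filter => /andP[ak /hs]; rewrite fE => hk.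
  move=> /andP[aj /hs]; rewrite fE => hj -> /=.
  rewrite -subr_le0.
  have -> : dot (al k1 *: j1.1 - al j1 *: k1.1) x
      - (al k1 * j1.2 - al j1 * k1.2) * t = al k1 * f j1 - al j1 * f k1.
    by rewrite !dotE /f; ring.
  by nra.
(* The largest lower bound on [s], with 0 included. *)
exists (\big[Num.max/0]_(k <- l | 0 < al k) (f k / al k)).
  by elim/big_rec: _ => // k s _ s0; rewrite le_max s0 orbT.
move=> k kl; rewrite fE.
have [ak|ak|ak] := ltgtP (al k) 0.
- suff : \big[Num.max/0]_(k <- l | 0 < al k) (f k / al k) <= f k / al k.
    by rewrite ler_ndivlMr.
  have fk : f k <= 0.
    by rewrite subr_le0; apply: h; rewrite mem_cat mem_filter kl ltW.
  rewrite big_seq_cond; apply: bigmax_le.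
    by rewrite -mulrNN mulr_ge0 ?oppr_ge0 // -?invrN ltW // invr_lt0.
  move=> j /andP[jl aj].
  have : dot (mix j k).1 x <= (mix j k).2 * t.
    apply: h; rewrite mem_cat; apply/orP; right; apply/allpairsP.
    by exists (j, k); rewrite !mem_filter aj ak jl kl.
  rewrite -subr_le0.
  have -> : dot (mix j k).1 x - (mix j k).2 * t = al j * f k - al k * f j.
    by rewrite /mix /= !dotE /f; ring.
  by rewrite ler_pdivrMr // mulrAC ler_ndivlMr // => ?; lra.
- rewrite -ler_pdivrMr //.
  exact: (le_bigmax_seq _ k (fun k => 0 < al k) (fun k => f k / al k)).
- rewrite ak mulr0 subr_le0; apply: h.
  by rewrite mem_cat mem_filter kl ak lexx.
Qed.

(* The convex hull is the slice [t = 1] of this cone, which is built by adding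
   one generator at a time. *)
Lemma weyl_cone m (p : 'I_m -> V) : exists l, forall x t,
  (exists a : 'I_m -> R,
     [/\ forall i, 0 <= a i, \sum_i a i = t & x = \sum_i a i *: p i]) <->
  (forall k, k \in l -> dot k.1 x <= k.2 * t).
Proof.
elim: m p => [|m IH] p.
  (* Without generators the cone is the origin: [t] and all coordinates of [x] are forced to
     vanish. *)
  exists ([:: (0, 1); (0, -1)] ++ [seq (delta_mx 0 i, 0) | i <- enum 'I_n]
      ++ [seq (- delta_mx 0 i, 0) | i <- enum 'I_n]) => x t.
  have dd i : dot (delta_mx 0 i) x = x 0 i.
    rewrite /dot (bigD1 i) //= mxE !eqxx mul1r big1 ?addr0 // => j ji.
    by rewrite mxE (negbTE ji) andbF mul0r.
  split=> [[a [_]]|h].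
    rewrite !big_ord0 => <- -> k; rewrite !mem_cat !inE.
    by case/orP=> [/orP[]/eqP ->|/orP[]/mapP[i _ ->]]; rewrite dot0r mulr0.
  have h1 : 0 <= t by have := h (0, 1) (mem_head _ _); rewrite /= !dotE mul1r.
  have h2 : t <= 0.
    by have := h (0, -1); rewrite /= !dotE !inE eqxx orbT => /(_ isT); lra.
  exists (fun=> 0); rewrite !big_ord0; split=> //; first lra.
  apply/rowP => i; rewrite mxE; apply/eqP; rewrite eq_le; apply/andP; split.
    have := h (delta_mx 0 i, 0); rewrite /= dd mul0r; apply.
    by rewrite !inE !mem_cat (map_f (fun i => (delta_mx 0 i, 0))) ?mem_enum ?orbT.
  have := h (- delta_mx 0 i, 0); rewrite /= !dotE dd mul0r oppr_le0; apply.
  by rewrite !inE !mem_cat (map_f (fun i => (- delta_mx 0 i, 0))) ?mem_enum ?orbT.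
have [l hl] := IH (fun i => p (lift ord0 i)).
have [l' hl'] := fourier_motzkin l (p ord0).
exists l' => x t; rewrite -hl'; split=> [[a [a0 sa xa]]|[s s0 /hl[a [a0 sa xa]]]].
  exists (a ord0) => //; apply/hl; exists (fun i => a (lift ord0 i)).
  rewrite -sa xa !big_ord_recl; split=> //.
    by rewrite [RHS]addrC addKr.
  by rewrite [LHS]addrC addKr.
exists (fun i => if unlift ord0 i is Some j then a j else s).
split=> [i||]; first by case: (unlift _ _).
  rewrite big_ord_recl unlift_none; under eq_bigr do rewrite liftK.
  by rewrite sa; ring.
rewrite big_ord_recl unlift_none; under eq_bigr do rewrite liftK.
by rewrite -xa addrC subrK.
Qed.

Lemma polytope_hpoly A : polytope A -> exists l, A = hpoly l.
Proof.
move=> [m [p ->]]; have [l hl] := weyl_cone p; exists l.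
apply/seteqP; split=> x.
  by move=> /hl h k /h; rewrite mulr1.
by move=> h; apply/hl => k /h; rewrite mulr1.
Qed.

Lemma polytope_no_ray A : polytope A -> no_ray A.
Proof.
move=> [m [p ->]] x w h; apply: contrapT => /dot_gt0 w0.
pose B := \sum_i `|dot w (p i)|.
have bd y : conv_hull p y -> dot w y <= B.
  move=> [a [a0 sa ->]].
  have -> : dot w (\sum_i a i *: p i) = \sum_i a i * dot w (p i).
    elim/big_rec2: _ => [|i u t _ IH]; first by rewrite dot0r.
    by rewrite !dotE IH.
  apply: ler_sum => i _.
  have ai : a i <= 1.
    by rewrite -sa (bigD1 i) //= lerDl sumr_ge0.
  apply: le_trans (ler_wpM2l (a0 i) (ler_norm _)) _.
  by rewrite ler_piMl.
have B0 : 0 <= B by rewrite sumr_ge0.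
(* Chosen so that [dot w] is at least [B + 1] at [x + s *: w]. *)
pose s := (B + `|dot w x| + 1) / dot w w.
have s0 : 0 <= s by rewrite divr_ge0 ?addr_ge0 // ltW.
have := bd _ (h s s0); rewrite !dotE /s mulfVK ?gt_eqF //.
by have := lerNnormlW (lexx `|dot w x|); lra.
Qed.

(** * Reflected sections and existence of minimizers *)

Lemma rhoE z A x : rho z A x <-> A (z *+ 2 - x).
Proof.
split=> [[y Ay <-]|Ax]; first by rewrite opprB addrC subrK.
by exists (z *+ 2 - x) => //; rewrite opprB addrC subrK.
Qed.

Lemma hpoly_rho l z : exists l', hpoly l `&` rho z (hpoly l) = hpoly l'.
Proof.
exists (l ++ [seq (- k.1, k.2 - 2 * dot k.1 z) | k <- l]).
have e k x : (dot k.1 (z *+ 2 - x) <= k.2) =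
             (dot (- k.1) x <= k.2 - 2 * dot k.1 z).
  by rewrite mulr2n !dotE; apply/idP/idP => ?; lra.
apply/seteqP; split=> x.
  move=> [hx /rhoE hzx] k; rewrite mem_cat => /orP[/hx//|/mapP[j jl ->]].
  by rewrite -e hzx.
move=> h; split; first by move=> k kl; apply: h; rewrite mem_cat kl.
apply/rhoE => k kl; rewrite e.
apply: (h (- k.1, _)).
by rewrite mem_cat (map_f (fun k => (- k.1, k.2 - 2 * dot k.1 z))) ?orbT.
Qed.

(** Lets a face inherit a minimizer from finitely many smaller faces. *)
Lemma finite_minimizer (T : eqType) (s : seq T) (S : T -> set V) v :
  (forall k : T, k \in s -> S k !=set0 -> minimizers v (S k) !=set0) ->
  (exists2 k : T, k \in s & S k !=set0) ->
  minimizers v [set x | exists2 k : T, k \in s & S k x] !=set0.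
Proof.
elim: s => [_ [] //|a s IH hm [k0 k0s Sk0]].
have [ex|nex] := pselect (exists2 k : T, k \in s & S k !=set0).
  have [|y [[k ks Sy] ymin]] := IH _ ex.
    by move=> k ks; apply: hm; rewrite inE ks orbT.
  have [Sa|Sa] := pselect (S a !=set0); last first.
    exists y; split=> [|x [j]]; first by exists k; rewrite // inE ks orbT.
    by rewrite inE => /orP[/eqP -> Sx|js Sx]; [case: Sa; exists x|apply: ymin; exists j].
  have [x [Sx xmin]] := hm a (mem_head _ _) Sa.
  have [xy|yx] := leP (dot x v) (dot y v).
    exists x; split=> [|z [j]]; first by exists a; rewrite ?mem_head.
    rewrite inE => /orP[/eqP -> /xmin//|js Sz].
    by apply: le_trans xy _; apply: ymin; exists j.
  exists y; split=> [|z [j]]; first by exists k; rewrite // inE ks orbT.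
  rewrite inE => /orP[/eqP -> /xmin|js Sz]; last by apply: ymin; exists j.
  by apply: le_trans; apply: ltW.
have Sa : S a !=set0.
  move: k0s; rewrite inE => /orP[/eqP <-//|k0s].
  by case: nex; exists k0.
have [x [Sx xmin]] := hm a (mem_head _ _) Sa.
exists x; split=> [|z [j]]; first by exists a; rewrite ?mem_head.
rewrite inE => /orP[/eqP -> /xmin//|js Sz].
by case: nex; exists j => //; exists z.
Qed.

(** Induction over the faces [S A] on which the constraints in [A] are tight. Unless [v] vanishes on
    all directions orthogonal to [A], each point can descend until a further constraint is tight, so
    the smaller faces decide the minimum. *)
Lemma hpoly_minimizer l v : no_ray (hpoly l) -> hpoly l !=set0 ->
  minimizers v (hpoly l) !=set0.
Proof.
move=> nr.
pose S (A : seq (V * R)) := [set x | hpoly l x /\ forall k, k \in A -> tight x k].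
suff main (A : seq (V * R)) : S A !=set0 -> minimizers v (S A) !=set0.
  move=> [x hx]; have [|y [[hy _] ymin]] := main [::]; first by exists x.
  by exists y; split=> // z hz; apply: ymin.
have [N] := ubnP (size l - count (mem A) l); elim: N A => // N IH A szN [x Sx].
have [cst|] := pselect (forall w, (forall k, k \in A -> dot k.1 w = 0) -> dot w v = 0).
  exists x; split=> // y [_ ty].
  suff : dot (y - x) v = 0 by rewrite dotBl; lra.
  by apply: cst => k kA; rewrite dotBr (eqP (ty k kA)) (eqP (Sx.2 k kA)) subrr.
move=> /existsNP[w0] /not_implyP[w0A w0v].
have [w wA wv] : exists2 w, (forall k, k \in A -> dot k.1 w = 0) & dot w v < 0.
  case: (ltgtP (dot w0 v) 0) w0v => // w0v _; first by exists w0.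
  exists (- w0); last by rewrite dotNl oppr_lt0.
  by move=> k kA; rewrite dotNr w0A ?oppr0.
have hit y : S A y -> exists z k, [/\ k \in l, 0 < dot k.1 w, S (k :: A) z
    & dot z v <= dot y v].
  move=> [hy ty].
  have [k kl kw] : exists2 k, k \in l & 0 < dot k.1 w.
    apply: contrapT => nk; have w00 : w = 0; last by rewrite w00 dot0l ltxx in wv.
    apply: (nr y) => s s0 k kl.
    have kw : dot k.1 w <= 0.
      by rewrite leNgt; apply/negP => kw; apply: nk; exists k.
    by have := hy k kl; rewrite !dotE; nra.
  have [||s [s0 hs [j [jl gj ej]]]] :=
      @first_hit R _ l (fun k => dot k.1 y - k.2) (fun k => dot k.1 w).
  - by move=> j jl; rewrite subr_le0 hy.
  - by exists k.
  exists (y + s *: w), j; split=> //; last first.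
    by rewrite !dotE gerDl mulr_ge0_le0 // ltW.
  split=> [i il|i]; first by have := hs i il; rewrite !dotE; lra.
  rewrite inE => /orP[/eqP ->|iA].
    by rewrite /tight !dotE -subr_eq0 -ej; apply/eqP; ring.
  by rewrite /tight !dotE wA // mulr0 addr0; apply: ty.
have [||z [[k _ [hz tz]] zmin]] :=
    @finite_minimizer _ [seq k <- l | 0 < dot k.1 w] (fun k => S (k :: A)) v.
- move=> k; rewrite mem_filter => /andP[kw kl]; apply: IH.
  rewrite ltnS in szN; apply: leq_trans szN.
  have lt : (count (mem A) l < count (mem (k :: A)) l)%N.
    apply: (@ltn_count _ _ _ _ k) => //=; rewrite ?mem_head //.
      by move=> j _ jA; rewrite inE jA orbT.
    by apply/negP => kA; rewrite wA ?ltxx in kw.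
  by apply: ltn_sub2l => //; apply: leq_trans lt _; apply: count_size.
- have [z [k [kl kw Sz _]]] := hit x Sx; exists k; last by exists z.
  by rewrite mem_filter kw.
exists z; split.
  by split=> // j jA; apply: tz; rewrite inE jA orbT.
move=> y /hit[y' [j [jl jw Sy']]]; apply: le_trans; apply: zmin.
by exists j => //; rewrite mem_filter jw.
Qed.

(** * Dimension, edges and minimizers *)

(** Adjoining vectors of [S] one at a time must stop, as dimensions are bounded. *)
Lemma subspace_ex (S : set V) : S 0 ->
  (forall a u v, S u -> S v -> S (a *: u + v)) ->
  exists U : {vspace V}, forall w, w \in U <-> S w.
Proof.
move=> S0 Slin; suff main (U : {vspace V}) : (forall w, w \in U -> S w) ->
    exists U : {vspace V}, forall w, w \in U <-> S w.
  by apply: (main 0%VS) => w; rewrite memv0 => /eqP ->.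
have [N] := ubnP (\dim {:V} - \dim U); elim: N U => // N IH U szN US.
have [full|] := pselect (forall w, S w -> w \in U).
  by exists U => w; split; [apply: US|apply: full].
move=> /existsNP[w] /not_implyP[Sw /negP wU].
apply: (IH (U + <[w]>)%VS) => [|x /memv_addP[u uU [_ /vlineP[a ->] ->]]]; last first.
  by rewrite addrC; apply: Slin => //; apply: US.
rewrite ltnS in szN; apply: leq_trans szN.
have lt : (\dim U < \dim (U + <[w]>))%N.
  rewrite (ltn_leqif (dimv_leqif_sup (addvSl U <[w]>))).
  by apply: contra wU; rewrite subv_add -memvE => /andP[].
by apply: ltn_sub2l => //; apply: leq_trans lt _; apply/dimvS/subvf.
Qed.

(** Differences of points of [A] lie in [U], which bounds the dimension above; a basis of [U],
    rescaled so that adding it to [x0] stays in [A], attains the bound. *)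
Lemma aff_dimE A x0 (U : {vspace V}) : A x0 ->
  (forall x, A x -> x - x0 \in U) ->
  (forall w, w \in U -> exists2 e, 0 < e & A (x0 + e *: w)) ->
  aff_dim A = \dim U.
Proof.
move=> Ax0 AU UA; apply/eqP; rewrite eqn_leq; apply/andP; split.
  apply/bigmax_leqP => k /asboolP[x1 [s [Ax1 sA sz fr]]].
  have <- : \dim <<[seq x - x1 | x <- s]>> = k.
    by move: fr; rewrite /free size_map sz => /eqP.
  apply/dimvS/span_subvP => _ /mapP[x xs ->].
  have -> : x - x1 = (x - x0) - (x1 - x0) by rewrite opprB addrA subrK.
  by apply: memvB; apply: AU => //; apply: sA.
have dn : (\dim U < n.+1)%N.
  by rewrite ltnS; apply: leq_trans (dimvS (subvf U)) _; rewrite dimvf /dim /= mul1n.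
apply: (@leq_bigmax_cond _ _ (fun k : 'I_n.+1 => k : nat) (Ordinal dn)).
apply/asboolP => /=.
have /choice[e he] : forall w, exists e, w \in U -> 0 < e /\ A (x0 + e *: w).
  by move=> w; have [/UA[e e0 Ae]|_] := boolP (w \in U); [exists e|exists 0].
exists x0, [seq x0 + e w *: w | w <- vbasis U]; split=> //.
- by move=> x /mapP[w /vbasis_mem /he[_ Aw] ->].
- by rewrite size_map size_tuple.
rewrite -map_comp /free size_map size_tuple eqn_leq.
rewrite (leq_trans (dim_span _)) ?size_map ?size_tuple //=.
apply: dimvS; rewrite -{1}(span_basis (vbasisP U)).
apply/span_subvP => w wb; have [e0 _] := he w (vbasis_mem wb).
rewrite -[w](scalerK (lt0r_neq0 e0)); apply: rpredZ; apply: memv_span.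
by apply/mapP; exists w => //=; rewrite addrC addKr.
Qed.

Lemma dim_hyperplane (U U' : {vspace V}) a w0 :
  (forall w, w \in U' <-> w \in U /\ dot a w = 0) ->
  w0 \in U -> dot a w0 <> 0 -> (\dim U').+1 = \dim U.
Proof.
move=> hU w0U /eqP aw0.
have w00 : w0 != 0 by apply: contra aw0 => /eqP ->; rewrite dot0r.
have -> : U = (U' + <[w0]>)%VS.
  apply/eqP; rewrite eqEsubv subv_add -memvE w0U andbT; apply/andP; split.
    apply/subvP => w wU; apply/memv_addP.
    exists (w - (dot a w / dot a w0) *: w0).
      apply/hU; split; first by rewrite rpredB ?rpredZ.
      by rewrite !dotE; field.
    exists ((dot a w / dot a w0) *: w0); first by rewrite rpredZ ?memv_line.
    by rewrite subrK.
  by apply/subvP => w /hU[].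
rewrite dimv_disjoint_sum ?dim_vline ?w00 ?addn1 //.
apply/eqP; rewrite -subv0; apply/subvP => w /memv_capP[/hU[_ aw] /vlineP[b e]].
move/eqP: aw; rewrite e dotZr mulf_eq0 (negbTE aw0) orbF => /eqP ->.
by rewrite scale0r mem0v.
Qed.

Lemma lineality_linear l x : lineality l x 0 /\
  forall a u v, lineality l x u -> lineality l x v -> lineality l x (a *: u + v).
Proof.
split=> [k _ _|a u v lu lv k kl tk]; first by rewrite dot0r.
by rewrite !dotE lu // lv // mulr0 addr0.
Qed.

Lemma lineality_step l x w : hpoly l x -> lineality l x w ->
  exists2 e, 0 < e & hpoly l (x + e *: w) /\ hpoly l (x - e *: w).
Proof.
move=> hx lw; have [|e e0 he] := @hpoly_step l x w hx.
  by move=> k kl tk; rewrite lw.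
have [|f f0 hf] := @hpoly_step l x (- w) hx.
  by move=> k kl tk; rewrite dotNr lw ?oppr0.
have ef : 0 < Num.min e f by rewrite lt_min e0.
exists (Num.min e f) => //; split.
  by apply: (he _ _).1; rewrite ge_min lexx ltW.
by rewrite -scalerN; apply: (hf _ _).1; rewrite ge_min lexx orbT ltW.
Qed.

(** A midpoint is tight only where both ends are, so averaging lowers the number of tight
    constraints until it reaches a point of the relative interior. *)
Lemma relint_ex l A : A `<=` hpoly l -> A !=set0 ->
  (forall x y, A x -> A y -> A (2^-1 *: (x + y))) ->
  exists2 x, A x & forall k, k \in l -> tight x k -> forall y, A y -> tight y k.
Proof.
move=> Al [x Ax] mid; have [N] := ubnP (count (tight x) l).
elim: N x Ax => // N IH x Ax szN.
have [rx|] := pselect (forall k, k \in l -> tight x k -> forall y, A y -> tight y k).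
  by exists x.
move=> /existsNP[k] /not_implyP[kl] /not_implyP[tx].
move=> /existsNP[y] /not_implyP[Ay /negP ty].
apply: (IH (2^-1 *: (x + y)) (mid x y Ax Ay)).
rewrite ltnS in szN; apply: leq_trans szN; apply: (@ltn_count _ _ _ _ k) => //.
  move=> j jl; rewrite /tight !dotE => /eqP tj; apply/eqP.
  by have := Al x Ax j jl; have := Al y Ay j jl; lra.
apply: contra ty; move: tx; rewrite /tight !dotE => /eqP tx /eqP tm; apply/eqP; lra.
Qed.

Lemma hpoly_mid l x y : hpoly l x -> hpoly l y -> hpoly l (2^-1 *: (x + y)).
Proof.
move=> hx hy k kl; have := hx k kl; have := hy k kl; rewrite !dotE; lra.
Qed.

(** The smallest face containing [m] has direction space spanned by [u]. *)
Lemma edge_through l m u : hpoly l m -> lineality l m u -> u <> 0 ->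
  (forall w, lineality l m w -> exists a, w = a *: u) ->
  exists E e, [/\ 0 < e, edge E (hpoly l) & edge_direction (e *: u) E].
Proof.
move=> hm lu u0 line.
(* Slacks are nonnegative on the polyhedron, so equality in the sum of the tight constraints forces
   equality in each. *)
pose d := \sum_(k <- l | (k \in l) && tight m k) k.1.
pose c := \sum_(k <- l | (k \in l) && tight m k) k.2.
have dc x : c - dot d x = \sum_(k <- l | (k \in l) && tight m k) (k.2 - dot k.1 x).
  rewrite sumrB; congr (_ - _).
  apply: (big_ind2 (fun u a => dot u x = a)) => [|u1 a1 u2 a2 <- <-|//].
    exact: dot0l.
  by rewrite dotDl.
have nn x : hpoly l x -> forall k, (k \in l) && tight m k -> 0 <= k.2 - dot k.1 x.
  by move=> hx k /andP[kl _]; rewrite subr_ge0 hx.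
pose E : set V := hpoly l `&` [set x | dot d x = c].
have EP x : E x <-> hpoly l x /\ forall k, k \in l -> tight m k -> tight x k.
  split=> [[hx /eqP]|[hx tx]].
    rewrite eq_sym -subr_eq0 dc psumr_eq0; last exact: nn.
    move=> /allP ht; split=> // k kl tk; have := ht k kl.
    by rewrite kl tk /= subr_eq0 eq_sym.
  split=> //; apply/esym/eqP; rewrite -subr_eq0 dc psumr_eq0; last exact: nn.
  apply/allP => k kl; apply/implyP => /andP[_ tk].
  by rewrite subr_eq0 eq_sym; apply: tx.
have Estep w : lineality l m w -> exists2 e, 0 < e & E (m + e *: w).
  move=> lw; have [e e0 [he _]] := lineality_step hm lw.
  exists e => //; apply/EP; split=> // k kl tk.
  by rewrite /tight !dotE lw // mulr0 addr0.
have Em : E m by apply/EP; split.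
have [e e0 Eu] := Estep u lu.
exists E, e; split=> //; last first.
  exists (m + e *: u), m; split=> //; last by rewrite addrC addKr.
  move/eqP; rewrite -subr_eq0 addrC addKr scaler_eq0 (gt_eqF e0) => /eqP.
  exact: u0.
split.
  exists d, c; split=> // x hx; rewrite -subr_ge0 dc.
  by apply: sumr_ge0 => k kl; apply: nn.
rewrite (@aff_dimE E m <[u]>%VS) ?dim_vline //; first by move/eqP: u0 => ->.
  move=> x /EP[hx tx]; apply/vlineP; apply: line => k kl tk.
  by rewrite dotBr (eqP tk) (eqP (tx k kl tk)) subrr.
move=> _ /vlineP[a ->]; apply: Estep => k kl tk.
by rewrite dotZr lu // mulr0.
Qed.

(** The edge need not contain [x]; only its direction is feasible there. *)
Lemma descending_edge l v x y : no_ray (hpoly l) ->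
  hpoly l x -> hpoly l y -> dot y v < dot x v ->
  exists E u, [/\ edge E (hpoly l), edge_direction u E, dot u v < 0
    & exists2 e, 0 < e & hpoly l (x + e *: u)].
Proof.
move=> nr hx hy yx.
have [m [u [hm lu line uv fu]]] := edge_descent nr hx hy yx.
have u0 : u <> 0 by move=> u0; rewrite u0 dot0l ltxx in uv.
have [E [e [e0 EE dE]]] := edge_through hm lu u0 line.
exists E, (e *: u); split=> //; first by rewrite dotZl pmulr_rlt0.
have [f f0 hf] := hpoly_step hx fu.
exists (f / e); first by rewrite divr_gt0.
rewrite scalerA divfK ?gt_eqF //; apply hf.
by rewrite lexx ltW.
Qed.

(* Cutting the polyhedron down to its face of minimizers only adds a constraint
   that is constant on every line through a minimizer, so an edge of that face
   is an edge of the whole polyhedron. *)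
Lemma minimizer_unique l v x y : no_ray (hpoly l) ->
  (forall E, edge E (hpoly l) -> forall d, edge_direction d E -> dot d v <> 0) ->
  minimizers v (hpoly l) x -> minimizers v (hpoly l) y -> x = y.
Proof.
move=> nr ori [hx xmin] [hy ymin]; apply: contrapT => xy.
pose l' := (v, dot v x) :: l.
have sub z : hpoly l' z -> hpoly l z.
  by move=> hz k kl; apply: hz; rewrite inE kl orbT.
have nr' : no_ray (hpoly l') by move=> z w h; apply: (nr z) => s /h/sub.
have l'I z : hpoly l z -> dot z v <= dot x v -> hpoly l' z.
  by move=> hz zx k; rewrite inE => /orP[/eqP -> /=|/hz//]; rewrite !(dotC v).
(* Inside the face of minimizers, the functional [x - y] is strictly smaller at [y] than at [x]. *)
have [|||m [u [hm lu line uu _]]] := @edge_descent l' (x - y) x y nr'.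
- exact: l'I.
- by apply: l'I => //; apply: ymin.
- by rewrite -subr_gt0 -dotBl dot_gt0 // => /eqP; rewrite subr_eq0 => /eqP.
have mx : dot m v = dot x v.
  apply/eqP; rewrite eq_le xmin ?andbT; last exact: sub.
  by have := hm _ (mem_head _ _); rewrite /= !(dotC v).
have u0 : u <> 0 by move=> u0; rewrite u0 dot0l ltxx in uu.
have uv : dot u v = 0.
  by rewrite dotC; apply: (lu (v, dot v x)); rewrite ?mem_head // /tight /= !(dotC v) mx.
have [|w lw|E [e [e0 EE dE]]] := @edge_through l m u (sub _ hm) _ u0.
- by move=> k kl tk; apply: lu; rewrite // inE kl orbT.
(* Minimality of [m] in both directions makes a lineality direction orthogonal to [v]. *)
- apply: line => k; rewrite inE => /orP[/eqP -> _ /=|]; last exact: lw.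
  have [e e0 [/xmin h1 /xmin h2]] := lineality_step (sub _ hm) lw.
  rewrite dotC; apply/eqP; rewrite -(mulrI_eq0 _ (mulfI (lt0r_neq0 e0))).
  by move: h1 h2; rewrite !dotE mx => h1 h2; apply/eqP; lra.
by apply: (ori _ EE _ dE); rewrite dotZl uv mulr0.
Qed.

(** * Facets and the arrangement *)

(* [J] is a representation of the polyhedron inside its affine hull with the
   fewest inequalities. Each [k] in [J] is violated at a point [y] satisfying
   all others, and the segment from [c] to [y] crosses the hyperplane of [k] in
   the relative interior of a facet. *)
Lemma facet_rep l c : hpoly l c ->
  (forall k, k \in l -> tight c k -> forall y, hpoly l y -> tight y k) ->
  exists J, (forall x, hpoly l x <-> lineality l c (x - c) /\ hpoly J x) /\
    forall k, k \in J -> let E := hpoly l `&` [set x | dot k.1 x = k.2] in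
      facet E (hpoly l) /\
      forall d w, outward_normal d E (hpoly l) -> lineality l c w ->
        0 < dot k.1 w -> 0 < dot d w.
Proof.
move=> hc rc.
pose rep J := forall x, hpoly l x <-> lineality l c (x - c) /\ hpoly J x.
have [J repJ minJ] : exists2 J, rep J & forall J', rep J' -> (size J <= size J')%N.
  have ex : exists m, `[< exists2 J, rep J & size J = m >].
    exists (size l); apply/asboolP; exists l => // x; split=> [hx|[]//].
    by split=> // k kl tk; rewrite dotBr (eqP tk) (eqP (rc k kl tk x hx)) subrr.
  case: (ex_minnP ex) => m /asboolP[J rJ <-] minm.
  by exists J => // J' rJ'; apply: minm; apply/asboolP; exists J'.
(* Otherwise [J] without [k] would be a shorter representation. *)
have wit k : k \in J ->
    exists y, [/\ lineality l c (y - c), hpoly (rem k J) y & k.2 < dot k.1 y].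
  move=> kJ; apply: contrapT => nex.
  have /minJ : rep (rem k J).
    move=> x; split=> [/repJ[lx hx]|[lx hx]].
      by split=> // j /mem_rem; apply: hx.
    apply/repJ; split=> // j jJ; have [->|jk] := eqVneq j k.
      by rewrite leNgt; apply/negP => kx; apply: nex; exists x.
    exact/hx/rem_mem.
  by rewrite size_rem //; case: (J) kJ => //= a s _; rewrite ltnn.
(* If [k] were tight at [c], a small step towards [y] would stay in the polyhedron and violate
   [k]. *)
have cJ k : k \in J -> dot k.1 c < k.2.
  move=> kJ; have [y [ly _ ky]] := wit k kJ.
  rewrite lt_neqAle ((repJ c).1 hc).2 // andbT; apply/eqP => ck.
  have [e e0 [h1 _]] := lineality_step hc ly.
  have := ((repJ _).1 h1).2 k kJ; rewrite !dotE ck => h.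
  have : 0 < e * (dot k.1 y - k.2) by rewrite mulr_gt0 ?subr_gt0.
  by lra.
exists J; split=> // k kJ E.
have [y [ly hy ky]] := wit k kJ; have ck := cJ k kJ.
pose w0 := y - c.
have kw0 : 0 < dot k.1 w0 by rewrite dotBr; lra.
have kw00 := lt0r_neq0 kw0.
pose s := (k.2 - dot k.1 c) / dot k.1 w0.
have s0 : 0 < s by rewrite divr_gt0 // subr_gt0.
have s1 : s < 1 by rewrite ltr_pdivrMr // mul1r dotBr; lra.
pose m := c + s *: w0.
have mk : dot k.1 m = k.2 by rewrite dotDr dotZr /s divfK //; ring.
have mj j : j \in J -> j != k -> dot j.1 m < j.2.
  move=> jJ jk; have yj := hy j (rem_mem jk jJ); have cj := cJ j jJ.
  have : 0 < (1 - s) * (j.2 - dot j.1 c) by rewrite mulr_gt0 ?subr_gt0.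
  have : 0 <= s * (j.2 - dot j.1 y) by rewrite mulr_ge0 ?subr_ge0 // ltW.
  by rewrite /m /w0 !dotE; lra.
have lm : lineality l c (m - c).
  by move=> j jl tj; rewrite /m addrC addKr dotZr ly // mulr0.
have hJm : hpoly J m.
  by move=> j jJ; have [->|/mj/ltW->//] := eqVneq j k; rewrite mk.
have hm : hpoly l m by apply/repJ.
have Em : E m by [].
have Estep w : lineality l c w -> dot k.1 w = 0 ->
    exists2 e, 0 < e & E (m + e *: w).
  move=> lw kw; have [|e e0 he] := @hpoly_step J m w hJm.
    move=> j jJ tj; have [->|jk] := eqVneq j k; first by rewrite kw.
    by have := mj j jJ jk; rewrite (eqP tj) ltxx.
  exists e => //; split; last by rewrite /= dotDr dotZr kw mulr0 addr0.
  apply/repJ; split; last by apply: (he _ _).1; rewrite lexx ltW.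
  by move=> j jl tj; rewrite addrAC dotDr dotZr lw // lm // mulr0 addr0.
have [l0 lD] := lineality_linear l c.
have [U hU] := subspace_ex l0 lD.
have [||U' hU'] := @subspace_ex (fun w => lineality l c w /\ dot k.1 w = 0).
- by rewrite dot0r.
- by move=> a u v [lu ku] [lv kv]; split; [exact: lD|rewrite !dotE ku kv mulr0 addr0].
split.
  split; [|by exists m|].
    by exists k.1, k.2; split=> // x /repJ[_ hx]; apply: hx.
  rewrite (@aff_dimE E m U') //; last 2 first.
  - move=> x [/repJ[lx _] kx]; apply/hU'; split.
      have -> : x - m = (-1) *: (m - c) + (x - c).
        by rewrite scaleN1r opprB [RHS]addrC subrKA.
      exact: lD.
    by rewrite dotBr kx mk subrr.
  - by move=> w /hU'[lw kw]; apply: Estep.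
  rewrite (@aff_dimE (hpoly l) c U) //; last 2 first.
  - by move=> x /repJ[lx _]; apply/hU.
  - move=> w /hU lw; have [e e0 [he _]] := lineality_step hc lw.
    by exists e.
  apply: (@dim_hyperplane U U' k.1 w0).
  - by move=> w; split=> [/hU'[lw kw]|[/hU lw kw]]; [split=> //; apply/hU|apply/hU'].
  - exact/hU.
  - exact/eqP.
(* On the lineality space at [c], [d] is a positive multiple of [k.1]: it vanishes where [k.1] does,
   and both are positive at [w0]. *)
move=> d w [b [EE dle]] lw kw.
have Eb x : E x -> dot d x = b by rewrite -EE => -[].
have dm := Eb m Em.
have d0 w' : lineality l c w' -> dot k.1 w' = 0 -> dot d w' = 0.
  move=> lw' kw'; have [e e0 /Eb] := Estep w' lw' kw'.
  rewrite dotDr dm dotZr -{2}[b]addr0 => /addrI/eqP.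
  by rewrite mulf_eq0 gt_eqF // => /eqP.
have dc : dot d c < b.
  rewrite lt_neqAle; apply/andP; split; last by rewrite leNgt; apply/negP/dle.
  apply/eqP => db; have : E c by rewrite -EE.
  by case=> _ /= kc; rewrite kc ltxx in ck.
have dw0 : 0 < dot d w0.
  by rewrite -(pmulr_rgt0 _ s0) -dotZr; move: dm; rewrite dotDr; lra.
have : dot d (- (dot k.1 w / dot k.1 w0) *: w0 + w) = 0.
  apply: d0; first exact: lD.
  by rewrite !dotE mulNr divfK //; lra.
rewrite dotDr dotZr mulNr => e.
have : 0 < dot k.1 w / dot k.1 w0 * dot d w0 by rewrite mulr_gt0 ?divr_gt0.
by lra.
Qed.

(** For [x] in the relative interior of [F], each constraint of [J] tight at [x] defines a facet
    containing [F], so the normals of these facets control feasibility. *)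
Lemma facet_feasible l c (F : set V) : hpoly l c ->
  (forall k, k \in l -> tight c k -> forall y, hpoly l y -> tight y k) ->
  face F (hpoly l) -> F !=set0 ->
  exists2 x, F x & forall (N : set V -> V) w,
    (forall E, facet E (hpoly l) -> F `<=` E -> outward_normal (N E) E (hpoly l)) ->
    lineality l c w ->
    (forall E, facet E (hpoly l) -> F `<=` E -> dot (N E) w <= 0) ->
    exists2 e, 0 < e & forall t, 0 <= t <= e -> hpoly l (x + t *: w).
Proof.
move=> hc rc [d [b [_ FE]]] F0.
have [J [repJ facJ]] := facet_rep hc rc.
have Fl : F `<=` hpoly l by rewrite FE => x [].
have [||x Fx rx] := @relint_ex J F _ F0.
- by move=> x /Fl/repJ[].
- move=> x y; rewrite FE => -[hx /= dx] [hy /= dy]; split; first exact: hpoly_mid.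
  by rewrite /= !dotE dx dy; field.
exists x => // N w hN lw Nw; have [lx hx] := (repJ x).1 (Fl x Fx).
have [|e e0 he] := @hpoly_step J x w hx.
  move=> k kJ tk; have [fE nE] := facJ k kJ.
  have FE' : F `<=` hpoly l `&` [set x | dot k.1 x = k.2].
    by move=> y Fy; split; [apply: Fl|apply/eqP/(rx k kJ tk)].
  rewrite leNgt; apply/negP => kw.
  have := nE _ w (hN _ fE FE') lw kw.
  by rewrite ltNge Nw.
exists e => // t te; apply/repJ; split; last by apply: (he t te).1.
have [_ lD] := lineality_linear l c.
by rewrite addrAC addrC; apply: lD.
Qed.

(** The component [r] of [d] orthogonal to [u] lies in the hyperplane, hence is orthogonal to [d],
    and so vanishes. *)
Lemma normal_parallel u d : u <> 0 -> normal_vector d (orthogonal_hyperplane u) ->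
  exists a, d = a *: u.
Proof.
move=> /dot_gt0 u0 [_ dH]; exists (dot d u / dot u u).
apply/eqP; rewrite -subr_eq0; apply/eqP; set r := d - _.
have ur : dot u r = 0.
  by rewrite /r dotBr dotZr divfK ?gt_eqF // dotC subrr.
apply: contrapT => /(@dot_gt0 r).
by rewrite {1}/r dotBl dotZl dH // ur mulr0 subrr ltxx.
Qed.

Lemma edge_direction_neq0 u E : edge_direction u E -> u <> 0.
Proof. by move=> [x [y [_ _ xy ->]]] /eqP; rewrite subr_eq0 => /eqP. Qed.

(* If a normal [f] of lin P were not constant on Q, some edge of Q ∩ ρ_c Q
   would not be orthogonal to [f], although it is parallel to an edge in P. *)
Lemma arrangement_lineality l c lQ cQ : no_ray (hpoly lQ) ->
  hpoly l c -> (forall k, k \in l -> tight c k -> forall y, hpoly l y -> tight y k) ->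
  hpoly lQ cQ ->
  (forall k, k \in lQ -> tight cQ k -> forall y, hpoly lQ y -> tight y k) ->
  aff_dim (hpoly l) = aff_dim (hpoly lQ) ->
  fundamental_arrangement (hpoly lQ) `<=` fundamental_arrangement (hpoly l) ->
  forall w, lineality l c w -> lineality lQ cQ w.
Proof.
move=> nr hc rc hcQ rcQ dim sub.
have [l0 lD] := lineality_linear l c; have [l0Q lDQ] := lineality_linear lQ cQ.
have [U hU] := subspace_ex l0 lD; have [UQ hUQ] := subspace_ex l0Q lDQ.
have dU l' c' (U' : {vspace V}) : hpoly l' c' ->
    (forall k, k \in l' -> tight c' k -> forall y, hpoly l' y -> tight y k) ->
    (forall w, w \in U' <-> lineality l' c' w) -> aff_dim (hpoly l') = \dim U'.
  move=> hc' rc' hU'; apply: (aff_dimE (x0 := c')) => //.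
    move=> x hx; apply/hU' => k kl tk.
    by rewrite dotBr (eqP tk) (eqP (rc' k kl tk x hx)) subrr.
  move=> w /hU' lw; have [e e0 [he _]] := lineality_step hc' lw; by exists e.
(* The reverse inclusion suffices because the dimensions agree. *)
suff UU : (UQ <= U)%VS.
  have /eqP UE : UQ == U.
    by rewrite eqEdim UU -(dU l c U hc rc hU) -(dU lQ cQ UQ hcQ rcQ hUQ) dim /=.
  by move=> w /hU; rewrite -UE => /hUQ.
apply/subvP => w /hUQ lw; apply/hU => k kl tk.
wlog kw : w lw / dot k.1 w < 0 => [wl|].
  case: (ltgtP (dot k.1 w) 0) => // kw; first exact: wl.
  have : dot k.1 (- w) = 0.
    apply: wl; last by rewrite dotNr oppr_lt0.
    by move=> j jl tj; rewrite dotNr lw ?oppr0.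
  by rewrite dotNr => /eqP; rewrite oppr_eq0 => /eqP.
(* Both [cQ + e *: w] and its reflection [cQ - e *: w] lie in Q, so the section at [cQ] has a point
   with a smaller value of [k.1]. *)
exfalso; have [e e0 [h1 h2]] := lineality_step hcQ lw.
have [lR RE] := hpoly_rho lQ cQ.
have [||||E [u [EE dE uk _]]] := @descending_edge lR k.1 cQ (cQ + e *: w).
- by move=> x y; rewrite -RE => h; apply: (nr x) => s /h[].
- by rewrite -RE; split=> //; apply/rhoE; rewrite mulr2n addrK.
- rewrite -RE; split=> //; apply/rhoE.
  by rewrite mulr2n opprD addrA addrK.
- by rewrite dotDl dotZl gtrDl pmulr_rlt0 // dotC.
have [|z [E' [u' [_ [[d [b [_ E'E]]] _] [x [y [E'x E'y xy eu]]] HE]]]] :=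
    sub (orthogonal_hyperplane u).
  by exists cQ, E, u; rewrite RE.
(* The vector [u'] joins two points of [hpoly l], on all of which [k] is tight. *)
have : orthogonal_hyperplane u' k.1.
  move: E'x E'y; rewrite E'E => -[[hx _] _] [[hy _] _].
  by rewrite /orthogonal_hyperplane /= dotC eu dotBr (eqP (rc k kl tk x hx))
    (eqP (rc k kl tk y hy)) subrr.
by rewrite -HE /orthogonal_hyperplane /= => uk0; rewrite uk0 ltxx in uk.
Qed.

(** Uniqueness of the minimizer determines what [xget] selects, and reflection in [z] transfers this
    to the maximizer. *)
Lemma diagonalE l v z x y : no_ray (hpoly l) ->
  positively_oriented (hpoly l) v -> hpoly l z ->
  Defs.diagonal (hpoly l) v z = (x, y) <->
  minimizers v (hpoly l `&` rho z (hpoly l)) x /\ y = z *+ 2 - x.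
Proof.
move=> nr ori hz; have := ori z hz; rewrite /Defs.diagonal.
have refl t : (hpoly l `&` rho z (hpoly l)) t ->
    (hpoly l `&` rho z (hpoly l)) (z *+ 2 - t).
  by move=> [ht /rhoE hrt]; split=> //; apply/rhoE; rewrite opprB addrC subrK.
have [lR RE] := hpoly_rho l z.
have nrR : no_ray (hpoly lR).
  by move=> t w; rewrite -RE => h; apply: (nr t) => s /h[].
have Rz : hpoly lR z.
  by rewrite -RE; split=> //; apply/rhoE; rewrite mulr2n addrK.
move: refl; rewrite RE => refl oriR.
have key t : minimizers v (hpoly lR) t ->
    (Defs.bot v (hpoly lR), Defs.top v (hpoly lR)) = (t, z *+ 2 - t).
  move=> mt; congr (_, _); apply: xget_unique => //.
  - by move=> s ms; apply: (minimizer_unique nrR oriR).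
  - case: (mt) => ht tmin; split=> [|s hs]; first exact: refl.
    by have := tmin _ (refl s hs); rewrite !dotBl; lra.
  - move=> s [hs smax]; rewrite -[s](subKr (z *+ 2)); congr (_ - _).
    apply: (minimizer_unique nrR oriR) => //; split=> [|r hr]; first exact: refl.
    by have := smax _ (refl r hr); rewrite !dotBl; lra.
split=> [|[mx ->]]; last exact: key.
(* Existence of a minimizer rules out the default value of [xget]. *)
have [t mt] : minimizers v (hpoly lR) !=set0.
  by apply: hpoly_minimizer => //; exists z.
by rewrite (key t mt) => -[<- <-].
Qed.

End Polyhedra.

(** * The criterion for a pair of faces to lie in the image of the diagonal *)

Theorem proposition1p33 (R : realType) (n : nat) (P Q : set 'rV[R]_n)
    (v : 'rV[R]_n) (d : set 'rV[R]_n -> 'rV[R]_n)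
    (F G : set 'rV[R]_n) (nF nG : set 'rV[R]_n -> 'rV[R]_n)
    (hP : polytope P) (hQ : polytope Q)
    (hdim : aff_dim P = aff_dim Q)
    (hQP : fundamental_arrangement Q `<=` fundamental_arrangement P)
    (hPv : positively_oriented P v) (hQv : positively_oriented Q v)
    (hd : forall H, fundamental_arrangement P H ->
       normal_vector (d H) H /\ 0 < dot (d H) v)
    (hF : face F Q) (hF0 : F !=set0) (hG : face G Q) (hG0 : G !=set0)
    (hnF : forall E, facet E Q -> F `<=` E -> outward_normal (nF E) E Q)
    (hnG : forall E, facet E Q -> G `<=` E -> outward_normal (nG E) E Q) :
  in_diagonal_image Q v F G <->
  (forall H, fundamental_arrangement P H ->
     (exists E, [/\ facet E Q, F `<=` E & dot (nF E) (d H) < 0]) \/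
     (exists E, [/\ facet E Q, G `<=` E & dot (nG E) (d H) > 0])).
Proof.
have nr := polytope_no_ray hQ.
have [l QE] := polytope_hpoly hQ; have [lP PE] := polytope_hpoly hP.
subst P Q.
have FQ : F `<=` hpoly l by case: hF => [a [b [_ ->]]] x [].
have GQ : G `<=` hpoly l by case: hG => [a [b [_ ->]]] x [].
split=> [im H HP|cond [x y] [/= Fx Gy]].
  have [dH dv] := hd H HP.
  have [|c hc rc] := @relint_ex _ _ l (hpoly l) (fun _ h => h) _ (@hpoly_mid _ _ l).
    by have [x /FQ] := hF0; exists x.
  (* [d H] is a multiple of an edge direction in P, hence parallel to the affine hull of P and so to
     that of Q. *)
  have ldH : lineality l c (d H).
    have [z [E [u [hz [[a [b [_ EE]]] _] dE HE]]]] := HP.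
    have [|cP hcP rcP] :=
      @relint_ex _ _ lP (hpoly lP) (fun _ h => h) _ (@hpoly_mid _ _ lP); first by exists z.
    apply: (arrangement_lineality nr hcP rcP hc rc hdim hQP) => k kl tk.
    have [b' ->] : exists b', d H = b' *: u.
      by apply: normal_parallel (edge_direction_neq0 dE) _; rewrite -HE.
    have [x [y [Ex Ey _ ->]]] := dE.
    move: Ex Ey; rewrite EE => -[[hx _] _] [[hy _] _].
    by rewrite dotZr dotBr (eqP (rcP k kl tk x hx)) (eqP (rcP k kl tk y hy)) subrr mulr0.
  have lNdH : lineality l c (- d H) by move=> k kl tk; rewrite dotNr ldH ?oppr0.
  apply: contrapT => /not_orP[nexF nexG].
  have [x Fx xfeas] := facet_feasible hc rc hF hF0.
  have [y Gy yfeas] := facet_feasible hc rc hG hG0.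
  have [|e e0 he] := xfeas nF (- d H) hnF lNdH.
    move=> E fE FE; rewrite dotNr oppr_le0 leNgt; apply/negP => lt.
    by apply: nexF; exists E.
  have [|f f0 hf] := yfeas nG (d H) hnG ldH.
    move=> E fE GE; rewrite leNgt; apply/negP => lt.
    by apply: nexG; exists E.
  have [z hz /(diagonalE _ _ nr hQv hz)[[_ xmin] yE]] := im (x, y) (conj Fx Gy).
  pose t := Num.min e f.
  have t0 : 0 < t by rewrite lt_min e0.
  (* The reflection of [x - t *: d H] in [z] is [y + t *: d H], so both lie in the section. *)
  have : dot x v <= dot (x + t *: - d H) v.
    apply: xmin; split; first by apply: he; rewrite ltW //= ge_min lexx.
    apply/rhoE; rewrite scalerN opprB addrCA addrC -yE.
    by apply: hf; rewrite ltW //= ge_min lexx orbT.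
  by rewrite dotDl dotZl dotNl; nra.
pose z := 2^-1 *: (x + y).
have z2 : z *+ 2 = x + y.
  by rewrite -scaler_nat scalerA divff ?scale1r // pnatr_eq0.
have hz : hpoly l z by apply: hpoly_mid; [apply: FQ|apply: GQ].
exists z => //; apply/(diagonalE _ _ nr hQv hz); rewrite z2; split; last first.
  by rewrite addrC addKr.
have Rx : (hpoly l `&` rho z (hpoly l)) x.
  split; first exact: FQ.
  by apply/rhoE; rewrite z2 addrC addKr; apply: GQ.
split=> // y' Ry'; rewrite leNgt; apply/negP => lt.
have [lR RE] := hpoly_rho l z.
have nrR : no_ray (hpoly lR).
  by move=> t w; rewrite -RE => h; apply: (nr t) => s /h[].
rewrite RE in Rx Ry'.
have [E [u [EE dE uv [e e0 hxe]]]] := descending_edge nrR Rx Ry' lt.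
have HQ : fundamental_arrangement (hpoly l) (orthogonal_hyperplane u).
  by exists z, E, u; rewrite RE.
have HP := hQP _ HQ; have [dH dv] := hd _ HP.
have [a da] := normal_parallel (edge_direction_neq0 dE) dH.
(* [u] descends along [v] while [d H] ascends. *)
have a0 : a < 0.
  by move: dv; rewrite da dotZl nmulr_lgt0.
move: hxe; rewrite -RE => -[hxe /rhoE]; rewrite z2 => hye.
(* An outward normal is maximal on its facet, so no feasible step from the facet increases it. *)
have bound N E' p q : outward_normal N E' (hpoly l) -> E' p -> hpoly l q ->
    dot N q <= dot N p.
  by move=> [b [<- nle]] [_ /= ->] hq; rewrite leNgt; apply/negP/nle.
case: (cond _ HP) => -[E' [fE' subE']]; rewrite da dotZr.
  rewrite nmulr_rlt0 // => Nu.
  have := bound _ _ _ _ (hnF _ fE' subE') (subE' _ Fx) hxe.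
  by rewrite dotDr dotZr gerDl leNgt mulr_gt0.
rewrite nmulr_rgt0 // => Nu.
have := bound _ _ _ _ (hnG _ fE' subE') (subE' _ Gy) hye.
have -> : x + y - (x + e *: u) = y - e *: u by rewrite opprD addrACA subrr add0r.
by rewrite dotBr dotZr gerBl leNgt => /negP; apply; rewrite pmulr_rlt0.
Qed.
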